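(* Let $Q_d$ be the $d$-dimensional hypercube, with $P=2^d$ vertices. Let $\tau$ be the time of a one-way communication graph consisting, for each vertex $v$, of a task graph containing a directed path from $v$ to every vertex other than $v$ and the unique vertex at distance $d$ from $v$. Then $\tau\ge \frac{2(P-2)}{d}$.
   Context: $Q_d$ has vertex set $\{0,1\}^d$, with $u,v$ adjacent iff they differ in exactly one coordinate; every edge is present in both directions. A task graph is a finite sequence $(e_i)$ of directed edges labeled by positive integer times $t(e_i)$ such that (i) $t(e_i)<t(e_j)$ implies $e_i<e_j$ or $e_i,e_j$ incomparable, and (ii) $t(e_i)=t(e_j)$ implies $i=j$ or $e_i,e_j$ incomparable, where $e_i<e_j$ means there is a directed path in the task graph beginning with $e_i$ and ending with $e_j$; its time is its maximum label. A one-way communication graph is a collection of task graphs in which no two edge occurrences joining the same two vertices (in either direction) carry the same label; its time is the maximum time of its task graphs. *)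

(* Defs.v *)
From mathcomp Require Import all_boot all_order all_algebra.

Set Implicit Arguments.
Unset Strict Implicit.
Unset Printing Implicit Defensive.

Definition cube (d : nat) : finType := {ffun 'I_d -> bool}.

Definition Qadj (d : nat) : rel (cube d) :=
  fun u v => #|[set i | u i != v i]| == 1.

(* Graph distance: [n] is the least length of a walk from [u] to [v]. *)
Definition at_distance (V : finType) (e : rel V) (n : nat) (u v : V) : Prop :=
  (exists p : seq V, [/\ path e u p, last u p = v & size p = n]) /\
  (forall p : seq V, path e u p -> last u p = v -> n <= size p).

(* A finite sequence of labeled directed edges; the same directed edge may
   occur at several indices. *)
Record edge_seq (V : finType) := EdgeSeq {
  len : nat;
  tail : 'I_len -> V;
  head : 'I_len -> V;
  label : 'I_len -> nat
}.

Section TaskGraph.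
Variables (V : finType) (e : rel V).
Implicit Type G : edge_seq V.

(* The edge occurrences [i :: s] are consecutive and the visited vertices are
   pairwise distinct. *)
Definition dipath G (i : 'I_(len G)) (s : seq 'I_(len G)) : bool :=
  path (fun j k => head j == tail k) i s &&
  uniq (tail i :: [seq head j | j <- i :: s]).

Definition precedes G (i j : 'I_(len G)) : Prop :=
  exists2 s : seq 'I_(len G), dipath i s & last i s = j.

Definition incomparable G (i j : 'I_(len G)) : Prop :=
  ~ precedes i j /\ ~ precedes j i.

Definition task_graph G : Prop :=
  [/\ forall i : 'I_(len G), e (tail i) (head i),
      forall i : 'I_(len G), 0 < label i,
      forall i j : 'I_(len G),
        label i < label j -> precedes i j \/ incomparable i j
    & forall i j : 'I_(len G),
        label i = label j -> i = j \/ incomparable i j].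

Definition time G : nat := \max_(i < len G) label i.

Definition has_dipath G (v w : V) : Prop :=
  exists (i : 'I_(len G)) (s : seq 'I_(len G)),
    [/\ dipath i s, tail i = v & head (last i s) = w].

Definition same_ends (u v u' v' : V) : Prop :=
  (u = u' /\ v = v') \/ (u = v' /\ v = u').

(* In the second clause [x] and [y] range over the edge occurrences of the
   whole collection: pairs of a task graph and an index in it. *)
Definition one_way_comm_graph (I : finType) (C : I -> edge_seq V) : Prop :=
  (forall a : I, task_graph (C a)) /\
  (forall x y : {a : I & 'I_(len (C a))},
     same_ends (tail (tagged x)) (head (tagged x))
               (tail (tagged y)) (head (tagged y)) ->
     label (tagged x) = label (tagged y) -> x = y).

Definition comm_time (I : finType) (C : I -> edge_seq V) : nat :=
  \max_(a : I) time (C a).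

End TaskGraph.

(* Main.v *)
Require Import Defs.
From mathcomp Require Import all_boot all_order all_algebra.
Import GRing.Theory Num.Theory.
Local Open Scope ring_scope.

(** Double counting. A task graph reaching [P - 2] vertices has at least
    [P - 2] edge occurrences, so the collection has at least [P * (P - 2)];
    on the other hand each of the [P * d / 2] undirected edges of the cube
    carries at most one occurrence for each label in [1 .. tau]. *)

Definition flip {d : nat} (u : cube d) (i : 'I_d) : cube d :=
  [ffun j => if j == i then ~~ u j else u j].

Lemma Qadj_flip (d : nat) (u : cube d) (i : 'I_d) : Qadj u (flip u i).
Proof.
rewrite /Qadj (_ : [set j | _] = [set i]) ?cards1 //.
by apply/setP=> j; rewrite !inE ffunE; case: (j == i); case: (u j).
Qed.

Lemma Qadj_flipP (d : nat) (u v : cube d) :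
  Qadj u v -> exists i, v = flip u i.
Proof.
move=> /cards1P[i Di]; exists i; apply/ffunP=> j; rewrite ffunE.
by have := in_set1 j i; rewrite -Di inE => <-; case: (u j) (v j) => [] [].
Qed.

Lemma Qadj_neq (d : nat) (u v : cube d) : Qadj u v -> u != v.
Proof.
apply: contraTneq => ->; rewrite /Qadj (_ : [set i | _] = set0) ?cards0 //.
by apply/setP=> i; rewrite !inE eqxx.
Qed.

Lemma hamming_path (d : nat) (u v : cube d) :
  exists p : seq (cube d),
    [/\ path (@Qadj d) u p, last u p = v & size p = #|[set i | u i != v i]|].
Proof.
move Dn: #|_| => n; elim: n u Dn => [|n IHn] u Dn.
  exists [::]; split=> //=; apply/ffunP=> i; apply/eqP.
  by move/eqP: Dn; rewrite cards_eq0 => /eqP/setP/(_ i); rewrite !inE => /negbFE.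
have /card_gt0P[i Di] : (0 < #|[set i | u i != v i]|)%N by rewrite Dn.
have [|p [pathp lastp sizep]] := IHn (flip u i).
  move: Dn; rewrite (cardsD1 i) Di => -[<-]; apply: eq_card => j.
  rewrite !inE ffunE; case: (eqVneq j i) => [->|] //=.
  by move: Di; rewrite inE; case: (u i); case: (v i).
by exists (flip u i :: p); rewrite /= Qadj_flip pathp sizep.
Qed.

Lemma at_distance_antipode (d : nat) (u v : cube d) :
  at_distance (@Qadj d) d u v -> v = [ffun i => ~~ u i].
Proof.
move=> [_ dmin]; have [p [pathp lastp sizep]] := hamming_path d u v.
have := dmin p pathp lastp; rewrite sizep -{1}(card_ord d) -cardsT => le_d.
have /eqP Dfull : [set i | u i != v i] == setT by rewrite eqEcard subsetT.
apply/ffunP=> i; rewrite ffunE; have := in_setT i; rewrite -Dfull inE.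
by case: (u i); case: (v i).
Qed.

Lemma card_Qadj (d : nat) :
  (#|[set uv : cube d * cube d | Qadj uv.1 uv.2]| <= 2 ^ d * d)%N.
Proof.
have -> : (2 ^ d * d)%N = #|{: cube d * 'I_d}|.
  by rewrite card_prod card_ffun card_bool !card_ord.
rewrite -cardsT.
apply: leq_trans (leq_imset_card (fun ui => (ui.1, flip ui.1 ui.2)) _).
apply/subset_leq_card/subsetP=> -[u v]; rewrite inE /= => /Qadj_flipP[i ->].
by apply/imsetP; exists (u, i); rewrite ?inE.
Qed.

Lemma has_dipath_card_le (V : finType) (G : edge_seq V) (v : V) (A : {set V}) :
  (forall w, w \in A -> has_dipath G v w) -> (#|A| <= len G)%N.
Proof.
move=> reachA; rewrite -[leqRHS]card_ord -cardsT.
apply: leq_trans (leq_imset_card (@Defs.head V G) _).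
apply/subset_leq_card/subsetP=> w /reachA[i [s [_ _ <-]]].
exact: imset_f.
Qed.

Lemma label_le_comm_time (V I : finType) (C : I -> edge_seq V)
  (a : I) (i : 'I_(len (C a))) : (label i <= comm_time C)%N.
Proof.
apply: leq_trans (leq_bigmax (F := fun a => time (C a)) a).
exact: (leq_bigmax (F := @label V (C a))).
Qed.

Lemma one_way_comm_graph_card (V I : finType) (e : rel V)
  (C : I -> edge_seq V) :
  (forall u v, e u v -> u != v) -> one_way_comm_graph e C ->
  (2 * \sum_(a : I) len (C a) <=
     #|[set uv : V * V | e uv.1 uv.2 || e uv.2 uv.1]| * comm_time C)%N.
Proof.
move=> e_neq [taskC uniqC].
pose T : finType := {a : I & 'I_(len (C a))}.
have -> : (2 * \sum_(a : I) len (C a))%N = #|{: bool * T}|.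
  rewrite card_prod card_bool card_tagged sumnE big_map big_enum /=.
  by congr (_ * _)%N; apply: eq_bigr => a _; rewrite card_ord.
(* Each occurrence is counted once per orientation. *)
pose ends (b : bool) (x : T) : V * V :=
  if b then (tail (tagged x), Defs.head (tagged x))
  else (Defs.head (tagged x), tail (tagged x)).
pose code (bx : bool * T) : (V * V) * 'I_(comm_time C).+1 :=
  (ends bx.1 bx.2, inord (label (tagged bx.2))).
have inord_label (x : T) :
    (inord (label (tagged x)) : 'I_(comm_time C).+1) = label (tagged x) :> nat.
  by rewrite inordK // ltnS label_le_comm_time.
have e_tagged (x : T) : e (tail (tagged x)) (Defs.head (tagged x)).
  by case: x => a i; have [] := taskC a.
have code_inj : injective code.
  move=> [b x] [c y] [Eends Elabel].
  have Exy : x = y.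
    apply: uniqC; last by rewrite -inord_label Elabel inord_label.
    by case: b c Eends => [] [] [-> ->]; [left | right | right | left].
  rewrite {}Exy in Eends *; congr (_, _).
  have := e_neq _ _ (e_tagged y).
  by case: b c Eends => [] [] //= [-> _]; rewrite eqxx.
rewrite -[comm_time C]/(comm_time C).+1.-1 -[X in X.-1]card_ord -(cardsC1 ord0).
rewrite -cardsX -cardsT -(card_imset _ code_inj).
apply/subset_leq_card/subsetP=> _ /imsetP[[b x] _ ->].
rewrite !inE /=; apply/andP; split.
  by have := e_tagged x; case: b => /= ->; rewrite ?orbT.
rewrite -val_eqE /= (inord_label x) -lt0n.
by have [_ -> _ _] := taskC (tag x).
Qed.

Theorem theorem3p3 (d : nat) (C : cube d -> edge_seq (cube d)) :
  one_way_comm_graph (@Qadj d) C ->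
  (forall v w : cube d,
     w <> v -> ~ at_distance (@Qadj d) d v w -> has_dipath (C v) v w) ->
  let P := (2 ^ d)%N in
  2 * (P%:R - 2) / d%:R <= (comm_time C)%:R :> rat.
Proof.
move=> commC reachC; cbv zeta; set P := (2 ^ d)%N.
(* For [d = 0] the quotient is a division by zero, hence [0]. *)
have [d0 | d_gt0] := posnP d.
  by rewrite [X in _ / X%:R]d0 invr0 mulr0 ler0n.
have cardP : #|cube d| = P by rewrite card_ffun card_bool card_ord.
have P_gt0 : (0 < P)%N by rewrite expn_gt0.
have len_ge v : (P - 2 <= len (C v))%N.
  pose B := [set v; [ffun i => ~~ v i] : cube d].
  apply: leq_trans (has_dipath_card_le _ (C v) v (~: B) _).
    rewrite cardsCs setCK cardP leq_sub2l // cards2.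
    by case: (_ != _).
  move=> w; rewrite !inE negb_or => /andP[/eqP w_v /eqP w_v'].
  by apply: reachC => // /at_distance_antipode.
have := one_way_comm_graph_card _ _ _ _ (Qadj_neq d) commC.
have -> : [set uv : cube d * cube d | Qadj uv.1 uv.2 || Qadj uv.2 uv.1]
        = [set uv | Qadj uv.1 uv.2].
  apply/setP=> uv; rewrite !inE orb_idr // /Qadj => /eqP <-; apply/eqP.
  by apply: eq_card => i; rewrite !inE eq_sym.
move=> upper.
have lower : (P * (P - 2) <= \sum_v len (C v))%N.
  by rewrite -cardP -sum_nat_const; apply: leq_sum => v _; rewrite cardP.
have : (P * (2 * (P - 2)) <= P * (d * comm_time C))%N.
  rewrite mulnCA [leqRHS]mulnA.
  apply: leq_trans (leq_mul (card_Qadj d) (leqnn (comm_time C))).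
  by apply: leq_trans upper; rewrite leq_mul2l.
rewrite leq_pmul2l // => bound.
have P_ge2 : (2 <= P)%N by rewrite -[2%N]expn1 leq_exp2l.
rewrite ler_pdivrMr ?ltr0n // -natrB // -!natrM ler_nat.
by rewrite [leqRHS]mulnC.
Qed.
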